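(* Let $\Gamma$ be a totally ordered set, $(A_\gamma)_{\gamma\in\Gamma}$ a family of ordered abelian groups, and $G=\coprod_{\gamma\in\Gamma}A_\gamma$ the Hahn sum, ordered lexicographically. Let $\mathrm{Aut}_\Gamma S(G)$ be the subgroup of $\mathrm{Aut}\,S(G)$ of automorphisms whose component on $\Gamma$ is the identity, and let $\mathrm{Aut}_\Gamma' S(G)$ be a complement of $\mathrm{Aut}_\Gamma S(G)$ in $\mathrm{Aut}\,S(G)$. Let $U$, $U^1$, $U^d$ be the matrix groups defined in the context. Then $$o\text{-}\mathrm{Aut}\,G=\left(U^1\rtimes U^d\right)\rtimes\mathrm{Aut}_\Gamma'S(G),$$ where $U^1,U^d$ are identified with their images in $o\text{-}\mathrm{Aut}\,G$ via the action of matrices on $G$, and $\mathrm{Aut}_\Gamma'S(G)$ is identified with its image in $o\text{-}\mathrm{Aut}\,G$ under the canonical lift.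
   Context: The Hahn sum $\coprod_{\Gamma}A_\gamma$ is the group of all $a\in\prod_\Gamma A_\gamma$ with finite support $\operatorname{supp}(a)=\{\gamma:a_\gamma\ne0\}$; elements are written $\sum_\gamma a_\gamma\mathbb{1}_\gamma:=(a_\gamma)_{\gamma\in\Gamma}$. Put $v(g)=\min\operatorname{supp}(g)$ for $g\neq0$. The lexicographic order is: $g>0$ iff $g\ne0$ and $g_{v(g)}>0$ in $A_{v(g)}$. $o\text{-}\mathrm{Aut}\,G$ is the group of automorphisms $\sigma$ of $G$ with $g>0\Rightarrow\sigma(g)>0$. The skeleton of $G$ is $S(G)=[\Gamma;\{A_\gamma:\gamma\in\Gamma\}]$. An automorphism of $S(G)$ is a tuple $\tau=[\tau_\Gamma;\{\tau_\gamma:\gamma\in\Gamma\}]$ with $\tau_\Gamma$ an automorphism of the ordered set $\Gamma$ and $\tau_\gamma\colon A_\gamma\to A_{\tau_\Gamma(\gamma)}$ an isomorphism of ordered groups for each $\gamma$; these form the group $\mathrm{Aut}\,S(G)$ under composition. The canonical lift of $\tau$ is the automorphism $\sum_\gamma g_\gamma\mathbb{1}_\gamma\mapsto\sum_\gamma\tau_\gamma(g_\gamma)\mathbb{1}_{\tau_\Gamma(\gamma)}$ of $G$. A complement of a normal subgroup $N$ in a group $H$ is a subgroup $K$ with $N\cap K=1$ and $NK=H$. Let $\Delta$ be the ring (under matrix addition and multiplication) of all $\Gamma\times\Gamma$-matrices $(\sigma_{\alpha\beta})$ with $\sigma_{\alpha\beta}\in\mathrm{Hom}(A_\beta,A_\alpha)$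 (so $\sigma_{\alpha\alpha}\in\mathrm{End}\,A_\alpha$) such that for every $\beta$ and every $a\in A_\beta$ one has $\sigma_{\alpha\beta}(a)=0$ for all but finitely many $\alpha$. A matrix in $\Delta$ acts on $G$ as the endomorphism $\sum_\gamma a_\gamma\mathbb{1}_\gamma\mapsto\sum_\alpha b_\alpha\mathbb{1}_\alpha$ with $b_\alpha=\sum_{\beta\in\operatorname{supp}(a)}\sigma_{\alpha\beta}(a_\beta)$. Let $T$ be the multiplicative monoid of all matrices in $\Delta$ that are lower triangular ($\sigma_{\alpha\beta}=0$ whenever $\alpha<\beta$) and whose diagonal entries $\sigma_{\alpha\alpha}$ are automorphisms of the ordered group $A_\alpha$. $U$ is the group of units (invertible matrices) in $T$; $U^1$ is the subgroup of $U$ of unitriangular matrices ($\sigma_{\alpha\alpha}=1$ for all $\alpha$); $U^d$ is the subgroup of diagonal matrices in $U$.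
   Formalization: All A_γ are assumed nonzero, and the equation for o-Aut G is stated for archimedean A_γ (it fails e.g. for Γ=Z, A_0=Z×Z lex, other A_n=Z); for arbitrary nonzero A_γ it is stated for the order automorphisms compatible with v. *)

(* Defs.v *)
From HB Require Import structures.
From mathcomp Require Import all_boot all_order all_algebra.
From mathcomp Require Import boolp classical_sets functions cardinality fsbigop.

Set Implicit Arguments.
Unset Strict Implicit.
Unset Printing Implicit Defensive.

Import Order.TTheory GRing.Theory.

Local Open Scope classical_set_scope.
Local Open Scope ring_scope.

Section InternalProducts.
Context {gT : groupType}.
Implicit Types N K H : set gT.

Definition is_subgroup H := H 1%g /\ forall x y, H x -> H y -> H (x / y)%g.

Definition mulset N K : set gT := [set (x * y)%g | x in N & y in K].

Definition is_complement N K H :=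
  [/\ is_subgroup K, N `&` K = [set 1%g] & mulset N K = H].

Definition is_normal_in N H :=
  [/\ is_subgroup N, N `<=` H & forall x y, N x -> H y -> N (x ^ y)%g].

(* H = N ><| K *)
Definition is_sdprod N K H :=
  [/\ is_subgroup H, is_normal_in N H & is_complement N K H].

End InternalProducts.

HB.mixin Record isOrderedAbelianGroup A of Num.POrderedZmodule A := {
  oag_le_total : total (<=%R : rel A);
  oag_lerD2r : forall x y z : A, x <= y -> x + z <= y + z
}.

#[short(type="oagType")]
HB.structure Definition OrderedAbelianGroup :=
  { A of isOrderedAbelianGroup A & Num.POrderedZmodule A }.

Definition archimedean_oag (A : oagType) :=
  forall x y : A, 0 < x -> exists n : nat, y <= x *+ n.

Definition is_oag_iso (A B : oagType) (f : {additive A -> B}) :=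
  bijective f /\ {mono f : x y / x <= y}.

Lemma additive_eq (U V : zmodType) (f g : {additive U -> V}) :
  f =1 g -> f = g.
Proof.
case: f g => [f [[f_add]]] [g [[g_add]]] /= /funext fg.
by case: _ / fg g_add => g_add; rewrite (Prop_irrelevance f_add g_add).
Qed.

Record zmodAut (V : zmodType) := ZmodAut {
  zmodAut_fun :> {additive V -> V};
  zmodAut_bij : bijective zmodAut_fun
}.

HB.instance Definition _ V := gen_eqMixin (zmodAut V).
HB.instance Definition _ V := gen_choiceMixin (zmodAut V).

Section ZmodAutGroup.
Context {V : zmodType}.
Implicit Types s t : zmodAut V.

Lemma zmodAut_eq s t : s =1 t -> s = t.
Proof.
case: s t => [f bf] [g bg] /= /additive_eq fg.
by case: _ / fg in bg *; rewrite (Prop_irrelevance bf bg).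
Qed.

Definition zmodAut_one : zmodAut V :=
  @ZmodAut V idfun (Bijective (fun=> erefl) (fun=> erefl)).

Definition zmodAut_mul s t : zmodAut V :=
  @ZmodAut V (s \o t) (bij_comp (zmodAut_bij s) (zmodAut_bij t)).

Lemma zmodAut_has_inv s : exists t, zmodAut_mul t s = zmodAut_one.
Proof.
case: s => s [t stK tsK] /=.
pose tA := GRing.isZmodMorphism.Build V V t (can2_zmod_morphism stK tsK).
pose t' : {additive V -> V} := HB.pack t tA.
by exists (@ZmodAut V t' (Bijective tsK stK)); apply: zmodAut_eq => x /=.
Qed.

Definition zmodAut_inv s : zmodAut V := projT1 (cid (zmodAut_has_inv s)).

Let mulA : associative zmodAut_mul.
Proof. by move=> s t u; apply: zmodAut_eq. Qed.
Let mul1s : left_id zmodAut_one zmodAut_mul.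
Proof. by move=> s; apply: zmodAut_eq. Qed.
Let muls1 : right_id zmodAut_one zmodAut_mul.
Proof. by move=> s; apply: zmodAut_eq. Qed.
Let mulVs : left_inverse zmodAut_one zmodAut_inv zmodAut_mul.
Proof. by move=> s; rewrite /zmodAut_inv; case: cid. Qed.
Let mulsV : right_inverse zmodAut_one zmodAut_inv zmodAut_mul.
Proof.
move=> s; rewrite -[LHS]mul1s -{1}(mulVs (zmodAut_inv s)) -mulA.
by rewrite [X in zmodAut_mul _ X]mulA mulVs mul1s mulVs.
Qed.

HB.instance Definition _ := isGroup.Build (zmodAut V) mulA mul1s muls1 mulVs mulsV.

End ZmodAutGroup.

Section HahnSum.
Context {d : Order.disp_t} {Gam : orderType d} (A : Gam -> oagType).

Record hahnSum := HahnSum {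
  hahn_coef :> forall c : Gam, A c;
  hahn_finite_supp : finite_set [set c | hahn_coef c != 0]
}.

HB.instance Definition _ := gen_eqMixin hahnSum.
HB.instance Definition _ := gen_choiceMixin hahnSum.

Definition supp (g : hahnSum) : set Gam := [set c | g c != 0].

Lemma hahn_eq (g h : hahnSum) : (forall c, g c = h c) -> g = h.
Proof.
case: g h => [g fg] [h fh] /= gh_eq.
have gh : g = h by exact: functional_extensionality_dep.
by case: _ / gh in fh gh_eq *; rewrite (Prop_irrelevance fg fh).
Qed.

Definition hahn_zero : hahnSum.
Proof.
apply: (@HahnSum (fun=> 0)).
by apply: (sub_finite_set _ (@finite_set0 Gam)) => c /=; rewrite eqxx.
Defined.

Definition hahn_opp (g : hahnSum) : hahnSum.
Proof.
apply: (@HahnSum (fun c => - g c)).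
by apply: (sub_finite_set _ (hahn_finite_supp g)) => c /=; rewrite oppr_eq0.
Defined.

Definition hahn_add (g h : hahnSum) : hahnSum.
Proof.
apply: (@HahnSum (fun c => g c + h c)).
have fin : finite_set (supp g `|` supp h).
  by rewrite finite_setU; split; exact: hahn_finite_supp.
apply: (sub_finite_set _ fin) => c /=; rewrite /supp /=.
by have [->|gc _] := eqVneq (g c) 0; [rewrite add0r; right | left].
Defined.

Let addA : associative hahn_add.
Proof. by move=> f g h; apply: hahn_eq => c /=; rewrite addrA. Qed.
Let addC : commutative hahn_add.
Proof. by move=> f g; apply: hahn_eq => c /=; rewrite addrC. Qed.
Let add0 : left_id hahn_zero hahn_add.
Proof. by move=> f; apply: hahn_eq => c /=; rewrite add0r. Qed.
Let addN : left_inverse hahn_zero hahn_opp hahn_add.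
Proof. by move=> f; apply: hahn_eq => c /=; rewrite addNr. Qed.

HB.instance Definition _ := GRing.isZmodule.Build hahnSum addA addC add0 addN.

(* a 1_c *)
Definition hahn_single (c : Gam) (a : A c) : hahnSum.
Proof.
apply: (@HahnSum (dfwith (fun c' => 0 : A c') a)).
apply: (sub_finite_set _ (finite_set1 c)) => c' /=.
by have [e _|ne] := eqVneq c c'; [exact: esym | rewrite dfwith_out ?eqxx].
Defined.

(* g != 0 and v(g) = c *)
Definition is_val (g : hahnSum) (c : Gam) :=
  supp g c /\ forall c', supp g c' -> (c <= c')%O.

Definition hahn_pos (g : hahnSum) := exists2 c, is_val g c & 0 < g c.

(* g, h != 0 and v(g) <= v(h) *)
Definition val_le (g h : hahnSum) :=
  exists c c', [/\ is_val g c, is_val h c' & (c <= c')%O].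

Definition oAut : set (zmodAut hahnSum) :=
  [set s | forall g, hahn_pos g -> hahn_pos (s g)].

(* If some A c is not archimedean, v need
   not be the natural valuation of the ordered group and oAut need not be
   contained in vAut: with Gam = Z, A 0 = Z x Z (lexicographic) and A c = Z for
   c != 0, the sum is isomorphic to the one with all components equal to Z, and
   the shift of the latter is not compatible with v. *)
Definition vAut : set (zmodAut hahnSum) :=
  [set s | forall g h, val_le g h <-> val_le (s g) (s h)].

End HahnSum.

Arguments hahnSum {d Gam} A.
Arguments oAut {d Gam} A.
Arguments vAut {d Gam} A.

Section SkeletonAut.
Context {d : Order.disp_t} {Gam : orderType d} (A : Gam -> oagType).

Record skelAut := SkelAut {
  skel_index : Gam -> Gam;
  skel_comp : forall c, {additive A c -> A (skel_index c)};
  skel_index_bij : bijective skel_index;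
  skel_index_mono : {mono skel_index : c c' / (c <= c')%O};
  skel_comp_iso : forall c, is_oag_iso (skel_comp c)
}.

HB.instance Definition _ := gen_eqMixin skelAut.
HB.instance Definition _ := gen_choiceMixin skelAut.

Lemma skelAut_eq (s t : skelAut) :
  (forall c (a : A c),
     Tagged A (skel_comp s c a) = Tagged A (skel_comp t c a)) -> s = t.
Proof.
case: s t => [f1 g1 b1 m1 i1] [f2 g2 b2 m2 i2] /= eq12.
have f12 : f1 = f2 by apply/funext => c; have /(congr1 tag) := eq12 c 0.
case: _ / f12 in g2 b2 m2 i2 eq12 *.
have g12 : g1 = g2.
  apply: functional_extensionality_dep => c; apply: additive_eq => a.
  exact: eq_from_Tagged (eq12 c a).
case: _ / g12 in i2 eq12 *.
by rewrite (Prop_irrelevance b1 b2) (Prop_irrelevance m1 m2)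
           (Prop_irrelevance i1 i2).
Qed.

Definition skelAut_one : skelAut.
Proof.
apply: (@SkelAut idfun (fun c => idfun)).
- by exists idfun.
- by [].
- by move=> c; split; [exists idfun | ].
Defined.

Definition skelAut_mul (s t : skelAut) : skelAut.
Proof.
apply: (@SkelAut (skel_index s \o skel_index t)
          (fun c => skel_comp s (skel_index t c) \o skel_comp t c)).
- exact: bij_comp (skel_index_bij s) (skel_index_bij t).
- by move=> c c' /=; rewrite !skel_index_mono.
- move=> c; have [bs ms] := skel_comp_iso s (skel_index t c).
  have [bt mt] := skel_comp_iso t c.
  by split; [exact: bij_comp | move=> a b /=; rewrite ms mt].
Defined.

Lemma skel_comp_inj (s : skelAut) c c' (a : A c) (b : A c') :
  Tagged A (skel_comp s c a) = Tagged A (skel_comp s c' b) ->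
  Tagged A a = Tagged A b.
Proof.
move=> ab; have cc' : c = c'.
  by have /(congr1 tag) := ab; exact: (bij_inj (skel_index_bij s)).
case: _ / cc' in b ab *; congr (Tagged A _).
by apply: (bij_inj (skel_comp_iso s c).1); exact: eq_from_Tagged ab.
Qed.

Let transport (B : oagType) c0 c (e : c0 = c) (k : B -> A c0)
    (h : {additive A c0 -> B}) :
  is_oag_iso h -> cancel h k ->
  exists2 h' : {additive A c -> B}, is_oag_iso h' &
    forall a, Tagged A (k (h' a)) = Tagged A a.
Proof. by move=> hiso hK; case: _ / e; exists h => // a; rewrite hK. Qed.

Lemma skelAut_has_inv (s : skelAut) : exists t, skelAut_mul t s = skelAut_one.
Proof.
have [f fK Kf] := skel_index_bij s.
have inv c : exists2 h : {additive A c -> A (f c)}, is_oag_iso h &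
    forall a, Tagged A (skel_comp s (f c) (h a)) = Tagged A a.
  have [[h hK Kh] hm] := skel_comp_iso s (f c).
  pose hA := GRing.isZmodMorphism.Build _ _ h (can2_zmod_morphism hK Kh).
  pose h' : {additive A (skel_index s (f c)) -> A (f c)} := HB.pack h hA.
  apply: (@transport _ _ _ (Kf c) _ h'); last by move=> a; exact: Kh.
  split; first by exists (skel_comp s (f c)).
  by move=> a b /=; rewrite -hm !Kh.
pose g c := s2val (cid2 (inv c)).
have gP c : is_oag_iso (g c) by rewrite /g; case: cid2.
have gK c a : Tagged A (skel_comp s (f c) (g c a)) = Tagged A a.
  by rewrite /g; case: cid2 => h.
have f_mono : {mono f : c c' / (c <= c')%O}.
  by move=> c c'; rewrite -(skel_index_mono s) !Kf.
exists (@SkelAut f g (Bijective Kf fK) f_mono gP).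
by apply: skelAut_eq => c a; apply: (@skel_comp_inj s); rewrite /= gK.
Qed.

Definition skelAut_inv (s : skelAut) : skelAut :=
  projT1 (cid (skelAut_has_inv s)).

Let mulA : associative skelAut_mul.
Proof. by move=> s t u; apply: skelAut_eq. Qed.
Let mul1s : left_id skelAut_one skelAut_mul.
Proof. by move=> s; apply: skelAut_eq. Qed.
Let muls1 : right_id skelAut_one skelAut_mul.
Proof. by move=> s; apply: skelAut_eq. Qed.
Let mulVs : left_inverse skelAut_one skelAut_inv skelAut_mul.
Proof. by move=> s; rewrite /skelAut_inv; case: cid. Qed.
Let mulsV : right_inverse skelAut_one skelAut_inv skelAut_mul.
Proof.
move=> s; rewrite -[LHS]mul1s -{1}(mulVs (skelAut_inv s)) -mulA.
by rewrite [X in skelAut_mul _ X]mulA mulVs mul1s mulVs.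
Qed.

HB.instance Definition _ := isGroup.Build skelAut mulA mul1s muls1 mulVs mulsV.

Definition skelAut_fix_index : set skelAut := [set s | skel_index s =1 id].

Definition skel_lift (s : skelAut) (g : hahnSum A) : hahnSum A :=
  \sum_(c \in supp g) hahn_single (skel_comp s c (g c)).

End SkeletonAut.

Arguments skelAut {d Gam} A.
Arguments skel_lift {d Gam A} s g.
Arguments skelAut_fix_index {d Gam} A.

Section Matrices.
Context {d : Order.disp_t} {Gam : orderType d} (A : Gam -> oagType).

Record Delta := DeltaMx {
  mx_entry :> forall r c : Gam, {additive A c -> A r};
  mx_col_finite : forall c (a : A c), finite_set [set r | mx_entry r c a != 0]
}.

HB.instance Definition _ := gen_eqMixin Delta.
HB.instance Definition _ := gen_choiceMixin Delta.

Lemma Delta_eq (M N : Delta) : (forall r c a, M r c a = N r c a) -> M = N.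
Proof.
case: M N => [M fM] [N fN] /= eqMN.
have MN : M = N.
  apply: functional_extensionality_dep => r.
  apply: functional_extensionality_dep => c.
  by apply: additive_eq => a; exact: eqMN.
by case: _ / MN in fN eqMN *; rewrite (Prop_irrelevance fM fN).
Qed.

Definition mx_zero : Delta.
Proof.
apply: (@DeltaMx (fun r c => \0)) => c a.
by apply: (sub_finite_set _ (@finite_set0 Gam)) => r /=; rewrite eqxx.
Defined.

Definition mx_opp (M : Delta) : Delta.
Proof.
apply: (@DeltaMx (fun r c => \- M r c)) => c a.
by apply: (sub_finite_set _ (mx_col_finite M a)) => r /=; rewrite oppr_eq0.
Defined.

Definition mx_add (M N : Delta) : Delta.
Proof.
apply: (@DeltaMx (fun r c => M r c \+ N r c)) => c a.
have fin : finite_set ([set r | M r c a != 0] `|` [set r | N r c a != 0]).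
  by rewrite finite_setU; split; exact: mx_col_finite.
apply: (sub_finite_set _ fin) => r /=.
by have [->|Mr _] := eqVneq (M r c a) 0; [rewrite add0r; right | left].
Defined.

Let id_entry_morphism r c : zmod_morphism (fun a : A c => hahn_single a r).
Proof.
move=> a b /=; have [e|ne] := eqVneq c r; last by rewrite !dfwith_out ?subr0.
by case: _ / e; rewrite !dfwith_in.
Qed.

Definition mx_one : Delta :=
  DeltaMx (mx_entry := fun r c =>
    HB.pack_for {additive A c -> A r} (fun a : A c => hahn_single a r)
      (GRing.isZmodMorphism.Build _ _ _ (@id_entry_morphism r c)))
    (fun c a => hahn_finite_supp (hahn_single a)).

Let fsumT (V : zmodType) (D : set Gam) (F : Gam -> V) :
    (forall k, ~ D k -> F k = 0) ->
  \sum_(k \in [set: Gam]) F k = \sum_(k \in D) F k.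
Proof. by move=> F0; apply/esym/fsbig_widen => // k [_ /F0]. Qed.

Let raddf_fsum (V W : zmodType) (f : {additive V -> W}) (D : set Gam)
    (F : Gam -> V) : finite_set D ->
  f (\sum_(k \in D) F k) = \sum_(k \in D) f (F k).
Proof. by move=> fD; rewrite !fsbig_finite//= raddf_sum. Qed.

Let col (M : Delta) c (a : A c) : set Gam := [set r | M r c a != 0].

Let col0 (M : Delta) c (a : A c) r : ~ col M a r -> M r c a = 0.
Proof. by move=> /negP; rewrite negbK => /eqP. Qed.

Let mul_entry_morphism (M N : Delta) r c :
  zmod_morphism (fun a : A c => \sum_(k \in [set: Gam]) M r k (N k c a)).
Proof.
move=> a b /=; pose D := col N a `|` col N b.
have fD : finite_set D by rewrite finite_setU; split; exact: mx_col_finite.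
have Na k : ~ D k -> N k c a = 0 by move=> Dk; apply: col0; apply: contra_not Dk; left.
have Nb k : ~ D k -> N k c b = 0 by move=> Dk; apply: col0; apply: contra_not Dk; right.
rewrite !(@fsumT _ D); first last.
- by move=> k Dk; rewrite raddfB Na// Nb// subr0 raddf0.
- by move=> k Dk; rewrite Na// raddf0.
- by move=> k Dk; rewrite Nb// raddf0.
rewrite !fsbig_finite//= -sumrB; apply: eq_bigr => k _.
by rewrite !raddfB.
Qed.

Let mul_col_finite (M N : Delta) c (a : A c) :
  finite_set [set r | \sum_(k \in [set: Gam]) M r k (N k c a) != 0].
Proof.
have fin : finite_set (\bigcup_(k in col N a) col M (N k c a)).
  by apply: bigcup_finite => [|k _]; exact: mx_col_finite.
apply: (sub_finite_set _ fin) => r /=; apply: contra_neqP => nr.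
rewrite (@fsumT _ (col N a)); last by move=> k /col0 ->; rewrite raddf0.
rewrite fsbig1// => k ak; apply: col0; apply: contra_not nr => rk.
by exists k.
Qed.

(* The (infinite) sum over k is finite at each argument. *)
Definition mx_mul (M N : Delta) : Delta :=
  DeltaMx (mx_entry := fun r c =>
    HB.pack_for {additive A c -> A r}
      (fun a : A c => \sum_(k \in [set: Gam]) M r k (N k c a))
      (GRing.isZmodMorphism.Build _ _ _ (@mul_entry_morphism M N r c)))
    (mul_col_finite M N).

Let addA : associative mx_add.
Proof. by move=> M N P; apply: Delta_eq => r c a /=; rewrite addrA. Qed.
Let addC : commutative mx_add.
Proof. by move=> M N; apply: Delta_eq => r c a /=; rewrite addrC. Qed.
Let add0 : left_id mx_zero mx_add.
Proof. by move=> M; apply: Delta_eq => r c a /=; rewrite add0r. Qed.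
Let addN : left_inverse mx_zero mx_opp mx_add.
Proof. by move=> M; apply: Delta_eq => r c a /=; rewrite addNr. Qed.

HB.instance Definition _ := GRing.isZmodule.Build Delta addA addC add0 addN.

Let mulA : associative mx_mul.
Proof.
move=> M N P; apply: Delta_eq => r c a /=.
pose D := col P a; pose E := \bigcup_(k in D) col N (P k c a).
have fD : finite_set D by exact: mx_col_finite.
have fE : finite_set E by apply: bigcup_finite => // k _; exact: mx_col_finite.
have P0 k : ~ D k -> P k c a = 0 by move=> /col0.
have N0 l k : ~ E l -> D k -> N l k (P k c a) = 0.
  by move=> El Dk; apply: col0; apply: contra_not El => ?; exists k.
have inner l : \sum_(k \in [set: Gam]) N l k (P k c a)
             = \sum_(k \in D) N l k (P k c a).
  by apply: fsumT => k /P0 ->; rewrite raddf0.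
under eq_fsbigr do rewrite inner.
rewrite (@fsumT _ E); last first.
  by move=> l El; rewrite fsbig1 ?raddf0// => k Dk; exact: N0.
rewrite [RHS](@fsumT _ D); last first.
  by move=> k /P0 ->; rewrite fsbig1// => l _; rewrite !raddf0.
under eq_fsbigr do rewrite raddf_fsum//.
rewrite exchange_fsbig//; apply: eq_fsbigr => k /set_mem Dk.
by rewrite [RHS](@fsumT _ E)// => l El; rewrite N0// raddf0.
Qed.
Let mul1 : left_id mx_one mx_mul.
Proof.
move=> M; apply: Delta_eq => r c a /=.
rewrite (@fsumT _ [set r]); last by move=> k kr; rewrite /= dfwith_out//; exact/eqP.
by rewrite fsbig_set1 /= dfwith_in.
Qed.
Let mulr1 : right_id mx_one mx_mul.
Proof.
move=> M; apply: Delta_eq => r c a /=.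
rewrite (@fsumT _ [set c]); last first.
  by move=> k kc; rewrite /= dfwith_out ?raddf0// eq_sym; exact/eqP.
by rewrite fsbig_set1 /= dfwith_in.
Qed.
Let mulDl : left_distributive mx_mul mx_add.
Proof.
move=> M N P; apply: Delta_eq => r c a /=; have fD := mx_col_finite P a.
rewrite !(@fsumT _ (col P a)); try by move=> k /col0 -> /=; rewrite ?raddf0 ?addr0.
by rewrite !fsbig_finite//= -big_split.
Qed.
Let mulDr : right_distributive mx_mul mx_add.
Proof.
move=> P M N; apply: Delta_eq => r c a /=; pose D := col M a `|` col N a.
have fD : finite_set D by rewrite finite_setU; split; exact: mx_col_finite.
have Ma k : ~ D k -> M k c a = 0 by move=> Dk; apply: col0; apply: contra_not Dk; left.
have Na k : ~ D k -> N k c a = 0 by move=> Dk; apply: col0; apply: contra_not Dk; right.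
rewrite !(@fsumT _ D); try by move=> k Dk /=; rewrite ?Ma ?Na ?addr0 ?raddf0.
by rewrite !fsbig_finite//= -big_split; apply: eq_bigr => k _ /=; rewrite raddfD.
Qed.

HB.instance Definition _ :=
  GRing.Zmodule_isPzRing.Build Delta mulA mul1 mulr1 mulDl mulDr.

Implicit Types M N : Delta.

Definition lower_triangular M :=
  forall r c : Gam, (r < c)%O -> M r c =1 (fun=> 0).

Definition mxT : set Delta :=
  [set M | lower_triangular M /\ forall c, is_oag_iso (M c c)].

Definition mxU : set Delta :=
  [set M | mxT M /\ exists N, [/\ mxT N, M * N = 1 & N * M = 1]].

Definition mxU1 : set Delta := [set M | mxU M /\ forall c, M c c =1 id].

Definition mxUd : set Delta :=
  [set M | mxU M /\ forall r c, r != c -> M r c =1 (fun=> 0)].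

Definition mx_act (M : Delta) (g : hahnSum A) : hahnSum A.
Proof.
apply: (@HahnSum _ _ A (fun r => \sum_(c \in supp g) M r c (g c))).
have fin : finite_set (\bigcup_(c in supp g) col M (g c)).
  by apply: bigcup_finite => [|c _]; [exact: hahn_finite_supp | exact: mx_col_finite].
apply: (sub_finite_set _ fin) => r /=; apply: contra_neqP => nr.
rewrite fsbig1// => c gc; apply: col0; apply: contra_not nr => rc.
by exists c.
Defined.

End Matrices.

Arguments Delta {d Gam} A.
Arguments mx_act {d Gam A} M g.
Arguments mxT {d Gam} A.
Arguments mxU {d Gam} A.
Arguments mxU1 {d Gam} A.
Arguments mxUd {d Gam} A.

Section Identification.
Context {V : zmodType} {X : Type} (F : X -> V -> V).

Definition aut_image (S : set X) : set (zmodAut V) :=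
  [set s : zmodAut V | exists2 x, S x & s =1 F x].

(* F identifies S, with the law mul, with a set of elements of H. *)
Definition identifies (mul : X -> X -> X) (S : set X) (H : set (zmodAut V)) :=
  [/\ forall x, S x -> exists2 s : zmodAut V, H s & s =1 F x,
      forall x y, S x -> S y -> F (mul x y) =1 F x \o F y
    & forall x y, S x -> S y -> F x =1 F y -> x = y].

End Identification.

(* Main.v *)
From HB Require Import structures.
Require Import Defs.
From mathcomp Require Import all_boot all_order all_algebra.
From mathcomp Require Import boolp classical_sets functions cardinality fsbigop.

Set Implicit Arguments.
Unset Strict Implicit.
Unset Printing Implicit Defensive.

Import Order.TTheory GRing.Theory.

Local Open Scope classical_set_scope.
Local Open Scope ring_scope.

(** Write [v] for the valuation of the Hahn sum [G], and let [W] be the group of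
    order automorphisms of [G] that fix [v].

    The image of [U] in the automorphisms of [G] is [W] ([aut_image_mxU]).  A
    triangular matrix with order isomorphisms on the diagonal multiplies the
    leading coefficient [g_c] of [g] by its [c]-th diagonal entry and produces
    nothing below [c], so it fixes [v] and preserves positivity.  Conversely, an
    endomorphism is determined by its values on the elements [a 1_c]
    ([additive_single_ext]), whose coordinates are the entries of a matrix;
    that the automorphism fixes [v] says that the matrix is triangular, and
    then its diagonal entries are order isomorphisms ([lead_iso]).  The inverse
    automorphism provides the inverse matrix.

    On triangular matrices, taking the diagonal part is multiplicative.  Hence
    [mx_diag] is an idempotent endomorphism of [U] with kernel [U^1] and image
    [U^d], and a group is the semidirect product of the kernel and the image of
    such an endomorphism ([mxU_sdprod]).

    An order automorphism [f] compatible with the preorder [v(g) <= v(h)] moves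
    all elements of valuation [c] to elements of one and the same valuation, and
    the map that it induces on leading coefficients is an order isomorphism; so
    [f] induces an automorphism of the skeleton ([induced_skelAut]), which is
    [e * k] with [k] in the complement and [e] trivial on the index set.
    Dividing [f] by the lift of [k] leaves an element of [W], whence
    [skel_sdprod].

    If the components are archimedean, then for positive [g] and [h] one has
    [v(g) <= v(h)] iff [h] is less than some multiple of [g]; this condition is
    preserved by order automorphisms, which are therefore all
    compatible with [v] ([oAut_sub_vAut]). *)

(** * Ordered abelian groups *)

Section OrderedGroups.
Context {A : oagType}.
Implicit Types a b : A.

Lemma oag_subr_ge0 a b : (0 <= b - a) = (a <= b).
Proof.
by apply/idP/idP => [/oag_lerD2r-/(_ a)|/oag_lerD2r-/(_ (- a))];
  rewrite ?add0r ?subrK ?subrr.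
Qed.

Lemma oag_subr_gt0 a b : (0 < b - a) = (a < b).
Proof. by rewrite !lt_def oag_subr_ge0 subr_eq0. Qed.

Lemma oag_oppr_gt0 a : (0 < - a) = (a < 0).
Proof. by rewrite -[- a]add0r oag_subr_gt0. Qed.

Lemma oag_neq0 a : a != 0 -> 0 < a \/ 0 < - a.
Proof.
move=> a0; case/orP: (oag_le_total 0 a) => a_sgn; [left|right].
  by rewrite lt_def a0.
by rewrite oag_oppr_gt0 lt_def eq_sym a0.
Qed.

Lemma oag_ltr_pwD a b : 0 < a -> 0 <= b -> 0 < a + b.
Proof.
move=> a0 b0; apply: (lt_le_trans a0); rewrite -oag_subr_ge0.
by rewrite addrC addKr.
Qed.

End OrderedGroups.

Section OrderedIsomorphisms.
Context {A B : oagType}.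
Implicit Types a b : A.

Lemma oag_iso_gt0 (f : {additive A -> B}) a :
  is_oag_iso f -> (0 < f a) = (0 < a).
Proof. by move=> [_ fm]; rewrite -(leW_mono fm) raddf0. Qed.

(** As the orders are total, a strictly positive additive map reflects the
    order and is injective. *)
Lemma oag_isoP (f : {additive A -> B}) :
  (forall a, 0 < a -> 0 < f a) -> (forall b : B, exists a, f a = b) ->
  is_oag_iso f.
Proof.
move=> f_gt0 f_surj.
have f_lt a b : a < b -> f a < f b.
  by rewrite -oag_subr_gt0 -[f a < _]oag_subr_gt0 -raddfB; exact: f_gt0.
have f_mono : {mono f : a b / a <= b}.
  move=> a b; have [->|ab] := eqVneq a b; first by rewrite !lexx.
  case/orP: (oag_le_total a b) => le_ab.
    by rewrite le_ab ltW// f_lt// lt_def eq_sym ab.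
  have lt_ba : b < a by rewrite lt_def ab.
  by rewrite (lt_geF lt_ba) (lt_geF (f_lt _ _ lt_ba)).
split=> //; have [g gK] := choice f_surj.
by exists g => // a; apply/(inc_inj f_mono); exact: gK.
Qed.

End OrderedIsomorphisms.

Lemma eq_oag_iso (A B : oagType) (f g : {additive A -> B}) :
  f =1 g -> is_oag_iso f -> is_oag_iso g.
Proof. by move=> /additive_eq ->. Qed.

(** * Coordinates, supports and valuation *)

Section HahnSums.
Context {d : Order.disp_t} {Gam : orderType d} {A : Gam -> oagType}.
Implicit Types (g h : hahnSum A) (c r : Gam).

Lemma supp0 g c : ~ supp g c -> g c = 0.
Proof. by move=> /negP; rewrite negbK => /eqP. Qed.

Lemma coef_sum (I : Type) (s : seq I) (P : pred I) (F : I -> hahnSum A) r :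
  (\sum_(i <- s | P i) F i) r = \sum_(i <- s | P i) F i r.
Proof. exact: (big_morph (fun g => g r)). Qed.

Lemma single_in c (a : A c) : hahn_single a c = a.
Proof. exact: dfwith_in. Qed.

Lemma single_out c (a : A c) r : r != c -> hahn_single a r = 0.
Proof. by move=> rc; rewrite /= dfwith_out// eq_sym. Qed.

Lemma single_zmod_morphism c : zmod_morphism (@hahn_single _ _ A c).
Proof.
move=> a b; apply: hahn_eq => r.
change (hahn_single (a - b) r = hahn_single a r - hahn_single b r).
have [->|rc] := eqVneq r c; first by rewrite !single_in.
by rewrite !single_out// subr0.
Qed.

HB.instance Definition _ c :=
  GRing.isZmodMorphism.Build _ _ (@hahn_single _ _ A c)
    (@single_zmod_morphism c).

Lemma hahn_sum_single g : g = \sum_(c \in supp g) hahn_single (g c).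
Proof.
have fg := hahn_finite_supp g.
apply: hahn_eq => r; rewrite fsbig_finite//= coef_sum -fsbig_finite//=.
have [gr|/negP gr] := boolP (g r != 0); last first.
  rewrite (supp0 gr) fsbig1// => c gc; rewrite dfwith_out//.
  by apply/eqP => cr; rewrite cr in gc.
rewrite -(@fsbig_widen _ _ _ _ [set r]).
- by rewrite fsbig_set1 dfwith_in.
- by move=> _ ->.
- by move=> c [_ /eqP cr]; rewrite /= dfwith_out.
Qed.

(** The elements [a 1_c] generate, so additive maps are compared on them. *)
Lemma additive_single_ext (V : zmodType) (f k : {additive hahnSum A -> V}) :
  (forall c (a : A c), f (hahn_single a) = k (hahn_single a)) -> f =1 k.
Proof.
move=> fk g; rewrite (hahn_sum_single g) fsbig_finite; last first.
  exact: hahn_finite_supp.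
by rewrite !raddf_sum; apply: eq_bigr => c _; exact: fk.
Qed.

Lemma is_valP g c :
  is_val g c <-> g c != 0 /\ forall r, (r < c)%O -> g r = 0.
Proof.
split=> [[gc cmin]|[gc cmin]]; split=> // r rc.
  by apply: supp0 => /cmin; rewrite leNgt rc.
by rewrite leNgt; apply: contra rc => /cmin ->.
Qed.

Lemma is_val_uniq g c r : is_val g c -> is_val g r -> c = r.
Proof. by move=> [gc cm] [gr rm]; apply/le_anti; rewrite cm// rm. Qed.

Lemma is_val_single c (a : A c) : a != 0 -> is_val (hahn_single a) c.
Proof.
move=> a0; apply/is_valP; rewrite single_in; split=> // r rc.
by rewrite single_out// lt_eqF.
Qed.

Lemma is_valN g c : is_val (- g) c <-> is_val g c.
Proof.
by split=> /is_valP [gc g0]; apply/is_valP; split=> [|r /g0];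
  rewrite /= ?oppr_eq0 in gc * => // /eqP; rewrite ?oppr_eq0 => /eqP // ->;
  rewrite oppr0.
Qed.

Lemma seq_has_min (s : seq Gam) : s != [::] ->
  exists2 m, m \in s & forall c, c \in s -> (m <= c)%O.
Proof.
elim: s => // x s IH _; have [->|/IH [m ms mmin]] := eqVneq s [::].
  by exists x => [|c]; rewrite ?mem_head// inE => /eqP ->.
exists (Order.min x m).
  by case: (leP x m) => _; rewrite inE ?eqxx// ms orbT.
move=> c; rewrite inE ge_min => /orP[/eqP ->|/mmin ->]; first by rewrite lexx.
by rewrite orbT.
Qed.

(** The support has a least element because it is finite; [Gam] itself may
    contain infinite descending sequences. *)
Lemma exists_val g : g != 0 -> exists c, is_val g c.
Proof.
have /finite_seqP [s sE] := hahn_finite_supp g.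
have memE c : (c \in s) = (g c != 0).
  have E : is_true (g c != 0) = is_true (c \in s) 
    by have := congr1 (fun X : set Gam => X c) sE.
  by apply/idP/idP; rewrite E.
move=> g0; have [|m ms mmin] := @seq_has_min s.
  apply: contra_neq g0 => s0; apply: hahn_eq => c.
  by apply: supp0; rewrite /supp /= -memE s0.
by exists m; split=> [|c]; rewrite /supp /= -memE//; exact: mmin.
Qed.

Lemma is_val_neq0 g c : is_val g c -> g != 0.
Proof. by move=> [/eqP gc _]; apply/eqP => g0; apply: gc; rewrite g0. Qed.

Lemma hahn_pos_coef g c : is_val g c -> hahn_pos g -> 0 < g c.
Proof. by move=> gc [r /(is_val_uniq gc) <-]. Qed.

Lemma hahn_pos_or_opp g : g != 0 -> hahn_pos g \/ hahn_pos (- g).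
Proof.
move=> /exists_val [c gc].
have [gc0|gc0] := oag_neq0 gc.1; [left|right]; exists c => //.
exact/is_valN.
Qed.

Lemma hahn_pos_neq0 g : hahn_pos g -> g != 0.
Proof. by move=> [c /is_val_neq0]. Qed.

Lemma hahn_posN g : hahn_pos g -> ~ hahn_pos (- g).
Proof.
move=> [c gc gc0] /(hahn_pos_coef ((is_valN g c).2 gc)) /=.
by rewrite oag_oppr_gt0 => /lt_trans/(_ gc0); rewrite ltxx.
Qed.

Lemma hahn_pos_single c (a : A c) : 0 < a -> hahn_pos (hahn_single a).
Proof.
move=> a0; exists c; rewrite ?single_in//.
by apply: is_val_single; rewrite gt_eqF.
Qed.

Lemma val_le_cmp g h c r :
  is_val g c -> is_val h r -> val_le g h <-> (c <= r)%O.
Proof.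
move=> gc hr; split=> [[c' [r' [gc' hr' le]]]|le]; last by exists c, r.
by rewrite (is_val_uniq gc gc') (is_val_uniq hr hr').
Qed.

Lemma val_le_eq g h c :
  is_val g c -> val_le g h -> val_le h g -> is_val h c.
Proof.
move=> gc [c1 [r [gc1 hr cr]]] [r' [c' [hr' gc' rc]]].
rewrite -(is_val_uniq gc gc1) in cr.
rewrite -(is_val_uniq gc gc') -(is_val_uniq hr hr') in rc.
by suff -> : c = r by []; apply/le_anti; rewrite cr rc.
Qed.

End HahnSums.

(** * Groups of automorphisms *)

Section Subgroups.
Context {gT : groupType}.
Implicit Types N K H : set gT.

Lemma subgroup_intro H : H 1%g -> (forall x y, H x -> H y -> H (x * y)%g) ->
  (forall x, H x -> H (x^-1)%g) -> is_subgroup H.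
Proof. by move=> H1 HM HV; split=> // x y Hx Hy; apply/HM/HV. Qed.

Lemma subgroupV H x : is_subgroup H -> H x -> H (x^-1)%g.
Proof. by move=> [H1 HB] /(HB _ _ H1); rewrite div1g. Qed.

Lemma subgroupM H x y : is_subgroup H -> H x -> H y -> H (x * y)%g.
Proof.
by move=> sH Hx /(subgroupV sH); rewrite -{2}[y]invgK; exact: sH.2.
Qed.

Lemma subgroupI H K : is_subgroup H -> is_subgroup K -> is_subgroup (H `&` K).
Proof.
by move=> [H1 HB] [K1 KB]; split=> // x y [Hx Kx] [Hy Ky]; split; auto.
Qed.

Lemma sdprod_intro N K H : is_subgroup H -> is_subgroup N -> N `<=` H ->
  is_subgroup K -> K `<=` H ->
  (forall x y, N x -> H y -> N (x ^ y)%g) ->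
  (forall x, N x -> K x -> x = 1%g) ->
  (forall x, H x -> exists2 k, K k & N (x / k)%g) ->
  is_sdprod N K H.
Proof.
move=> sH sN NH sK KH nN NK1 NK; split=> //; split=> //.
  apply/seteqP; split=> [x [Nx Kx]|_ ->]; first exact: NK1.
  by split; [exact: sN.1 | exact: sK.1].
apply/seteqP; split=> [_ [x Nx [y Ky <-]]|x /NK [k Kk Nxk]].
  exact: subgroupM sH (NH _ Nx) (KH _ Ky).
by exists (x / k)%g => //; exists k => //; rewrite divgK.
Qed.

End Subgroups.

Section ZmodAutomorphisms.
Context {V : zmodType}.
Implicit Types s t : zmodAut V.

Lemma zmodAutVK s g : (s^-1)%g (s g) = g.
Proof. exact: (congr1 (fun t : zmodAut V => t g) (mulVg s)). Qed.

Lemma zmodAutKV s g : s ((s^-1)%g g) = g.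
Proof. exact: (congr1 (fun t : zmodAut V => t g) (mulgV s)). Qed.

Lemma zmodAutV_eq s (k : V -> V) : cancel s k -> (s^-1)%g =1 k.
Proof. by move=> sk g; rewrite -{2}(zmodAutKV s g) sk. Qed.

Lemma exists_zmodAut (f : {additive V -> V}) (k : V -> V) :
  cancel f k -> cancel k f -> exists s : zmodAut V, s =1 f.
Proof. by move=> fk kf; exists (ZmodAut (Bijective fk kf)). Qed.

Lemma aut_image_subgroup (X : Type) (F : X -> V -> V) (S : set X) :
  (exists2 x, S x & F x =1 id) ->
  (forall x y, S x -> S y -> exists2 z, S z & F z =1 F x \o F y) ->
  (forall x, S x -> exists2 y, S y & cancel (F x) (F y)) ->
  is_subgroup (aut_image F S).
Proof.
move=> [e Se Fe] SM SV; apply: subgroup_intro.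
- by exists e => // g; rewrite Fe.
- move=> s t [x Sx sx] [y Sy ty]; have [z Sz Fz] := SM x y Sx Sy.
  by exists z => // g; rewrite Fz /= -ty -sx.
- move=> s [x Sx sx]; have [y Sy xy] := SV x Sx.
  by exists y => //; apply: zmodAutV_eq => g; rewrite sx xy.
Qed.

End ZmodAutomorphisms.

Section HahnAutomorphisms.
Context {d : Order.disp_t} {Gam : orderType d} {A : Gam -> oagType}.
Implicit Types (g h : hahnSum A) (c r : Gam) (s t : zmodAut (hahnSum A)).

Definition val_fixing : set (zmodAut (hahnSum A)) :=
  [set s | forall g c, is_val g c -> is_val (s g) c].

Lemma zmodAut_neq0 s g : g != 0 -> s g != 0.
Proof.
by apply: contra_neq => sg0; rewrite -(zmodAutVK s g) sg0 raddf0.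
Qed.

(** A negative element cannot become positive, as its opposite stays
    positive: this is where totality of the order of the sum enters. *)
Lemma oAutV s : oAut A s -> oAut A (s^-1)%g.
Proof.
move=> s_pos g g_pos.
have /(zmodAut_neq0 (s^-1)%g)/hahn_pos_or_opp [//|] := hahn_pos_neq0 g_pos.
by move=> /s_pos; rewrite raddfN zmodAutKV => /(hahn_posN g_pos).
Qed.

Lemma oAut_subgroup : is_subgroup (oAut A).
Proof.
apply: subgroup_intro => //; last by move=> s; exact: oAutV.
by move=> s t s_pos t_pos g /t_pos/s_pos.
Qed.

Lemma vAut_subgroup : is_subgroup (vAut A).
Proof.
apply: subgroup_intro => // [s t sv tv g h|s sv g h].
  by rewrite (tv g h); exact: sv.
by rewrite (sv ((s^-1)%g g)) !zmodAutKV.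
Qed.

Lemma val_fixingV s : val_fixing s -> val_fixing (s^-1)%g.
Proof.
move=> sv g c gc.
have [r gr] := exists_val (zmodAut_neq0 (s^-1)%g (is_val_neq0 gc)).
have /(is_val_uniq gc) -> // : is_val g r.
by rewrite -(zmodAutKV s g); exact: sv.
Qed.

Lemma val_fixing_subgroup : is_subgroup val_fixing.
Proof.
apply: subgroup_intro => //; last exact: val_fixingV.
by move=> s t sv tv g c /tv/sv.
Qed.

Lemma val_fixing_vAut : val_fixing `<=` vAut A.
Proof.
move=> s sv g h; split=> [[c [r [gc hr cr]]]|[c [r [gc hr cr]]]].
  by exists c, r; split=> //; exact: sv.
by exists c, r; split=> //; rewrite -[X in is_val X](zmodAutVK s);
  exact: val_fixingV.
Qed.

(** Surjectivity: given [b], the element [h = s^-1 (b 1_r)] has valuation [c],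
    and [e = h - h_c 1_c] has no component at [c].  Since [s e] vanishes below
    [r], it must also vanish at [r], for otherwise [e] would have valuation
    [c]; so [h_c] is a preimage of [b]. *)
Lemma lead_iso s c r (f : {additive A c -> A r}) : oAut A s ->
  (forall g, is_val g c -> is_val (s g) r) ->
  (forall g, is_val g r -> is_val ((s^-1)%g g) c) ->
  (forall a, f a = s (hahn_single a) r) -> is_oag_iso f.
Proof.
move=> s_pos s_cr s_rc fE; apply: oag_isoP => [a a0|b].
  rewrite fE; apply: hahn_pos_coef; last exact/s_pos/hahn_pos_single.
  by apply: s_cr; apply: is_val_single; rewrite gt_eqF.
have [->|b0] := eqVneq b 0; first by exists 0; rewrite raddf0.
set h := (s^-1)%g (hahn_single b).
have hc : is_val h c by apply/s_rc/is_val_single.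
have sh : s h = hahn_single b by rewrite zmodAutKV.
exists (h c); rewrite fE; apply/esym/eqP; rewrite -subr_eq0.
set e := h - hahn_single (h c).
have se r' : s e r' = s h r' - s (hahn_single (h c)) r' by rewrite raddfB.
rewrite -[X in X - _](single_in b) -sh -se; apply/negPn/negP => se_r.
have ec : is_val e c.
  rewrite -(zmodAutVK s e); apply/s_rc/is_valP.
  split=> // r' lt_r'r; rewrite se.
  have /is_valP [_ ->//] := s_cr _ hc.
  by have /is_valP [_ ->] := s_cr _ (is_val_single hc.1); rewrite ?subrr.
have /is_valP [/eqP] := ec; case.
by rewrite [LHS](_ : _ = h c - hahn_single (h c) c)// single_in subrr.
Qed.

End HahnAutomorphisms.
Arguments val_fixing {d Gam} A.

(** * Matrices *)

Section MatrixAction.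
Context {d : Order.disp_t} {Gam : orderType d} {A : Gam -> oagType}.
Implicit Types (g h : hahnSum A) (c r : Gam) (M N : Delta A).

Lemma mx_actE M g r (D : set Gam) : supp g `<=` D ->
  mx_act M g r = \sum_(c \in D) M r c (g c).
Proof.
by move=> gD; apply: fsbig_widen => // c [_ /supp0] /= ->; rewrite raddf0.
Qed.

Lemma mx_act_single M c (a : A c) r : mx_act M (hahn_single a) r = M r c a.
Proof.
rewrite (@mx_actE _ _ _ [set c]) ?fsbig_set1 ?single_in// => k.
have [->//|kc ka] := eqVneq k c; case/eqP: (ka : hahn_single a k != 0).
exact: single_out.
Qed.

Lemma mx_act_zmod_morphism M : zmod_morphism (mx_act M).
Proof.
move=> g h; apply: hahn_eq => r; pose D := supp g `|` supp h.
have fD : finite_set D by rewrite finite_setU; split; exact: hahn_finite_supp.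
rewrite [RHS](_ : _ = mx_act M g r - mx_act M h r)//.
rewrite !(@mx_actE _ _ _ D); last first.
- move=> c gh_c; apply: contrapT => Dc; case/eqP: (gh_c : g c - h c != 0).
  by rewrite !supp0 ?subr0// => ?; apply: Dc; [right|left].
- by move=> c; left.
- by move=> c; right.
by rewrite !fsbig_finite//= -sumrB; apply: eq_bigr => c _; rewrite -raddfB.
Qed.

HB.instance Definition _ M :=
  GRing.isZmodMorphism.Build _ _ (mx_act M) (mx_act_zmod_morphism M).

Lemma mx_act_mul M N g : mx_act (M * N) g = mx_act M (mx_act N g).
Proof.
move: g; apply: (additive_single_ext (k := mx_act M \o mx_act N)) => c a.
apply: hahn_eq => r.
rewrite mx_act_single; change (\sum_(k \in [set: Gam]) M r k (N k c a) =
  mx_act M (mx_act N (hahn_single a)) r).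
rewrite (@mx_actE _ _ _ [set: Gam])//.
by apply: eq_fsbigr => k _; rewrite mx_act_single.
Qed.

Lemma mx_act1 : mx_act (1 : Delta A) =1 id.
Proof.
apply: (@additive_single_ext _ _ _ _ _ idfun) => c a.
by apply: hahn_eq => r; rewrite mx_act_single.
Qed.

Lemma mx_act_inj M N : mx_act M =1 mx_act N -> M = N.
Proof.
by move=> MN; apply: Delta_eq => r c a; rewrite -!mx_act_single MN.
Qed.

Definition coef r g : A r := g r.
Lemma coef_zmod_morphism r : zmod_morphism (coef r). Proof. by []. Qed.
HB.instance Definition _ r :=
  GRing.isZmodMorphism.Build _ _ (coef r) (@coef_zmod_morphism r).

Definition mx_of (f : {additive hahnSum A -> hahnSum A}) : Delta A :=
  DeltaMx (mx_entry := fun r c => coef r \o f \o @hahn_single _ _ A c)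
    (fun c a => hahn_finite_supp (f (hahn_single a))).

Lemma mx_act_of f : mx_act (mx_of f) =1 f.
Proof.
apply: additive_single_ext => c a; apply: hahn_eq => r.
by rewrite mx_act_single.
Qed.

End MatrixAction.

(** * Triangular matrices *)

Section Triangular.
Context {d : Order.disp_t} {Gam : orderType d} {A : Gam -> oagType}.
Implicit Types (g h : hahnSum A) (c r : Gam) (M N : Delta A).

Lemma mx_mulE M N r c (a : A c) :
  (M * N) r c a = \sum_(k \in [set: Gam]) M r k (N k c a).
Proof. by []. Qed.

Lemma mx1_diag c (a : A c) : (1 : Delta A) c c a = a.
Proof. exact: single_in. Qed.

Lemma mx1_off r c (a : A c) : r != c -> (1 : Delta A) r c a = 0.
Proof. exact: single_out. Qed.

(** In the sum over [k] of [M c k (N k c a)], the second factor vanishes for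
    [k < c] and the first one for [k > c]. *)
Lemma tri_mul_diag M N c (a : A c) :
  lower_triangular M -> lower_triangular N -> (M * N) c c a = M c c (N c c a).
Proof.
move=> Mt Nt; rewrite mx_mulE -(@fsbig_widen _ _ _ _ [set c]) ?fsbig_set1//.
move=> k [_ /eqP kc] /=; case: (ltgtP k c) kc => // [/Nt ->|/Mt ->] // _.
by rewrite raddf0.
Qed.

Lemma mxT_mul M N : mxT A M -> mxT A N -> mxT A (M * N).
Proof.
move=> [Mt Mi] [Nt Ni]; split=> [r c rc a|c].
  rewrite mx_mulE fsbig1// => k _.
  have [/Nt ->|ck] := ltP k c; first by rewrite raddf0.
  by rewrite Mt// (lt_le_trans rc).
apply: (@eq_oag_iso _ _ (M c c \o N c c)).
  by move=> a; rewrite tri_mul_diag.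
have [[bM mM] [bN mN]] := (Mi c, Ni c); split; first exact: bij_comp.
by move=> a b /=; rewrite mM mN.
Qed.

Lemma mxT1 : mxT A 1.
Proof.
split=> [r c rc a|c]; first by rewrite mx1_off// lt_eqF.
apply: (@eq_oag_iso _ _ idfun) => [a|]; first by rewrite mx1_diag.
by split=> //; exists id.
Qed.

Lemma tri_act_lead M g c :
  lower_triangular M -> is_val g c -> mx_act M g c = M c c (g c).
Proof.
move=> Mt /is_valP [_ g0]; rewrite (@mx_actE _ _ _ _ _ _ [set: Gam])//.
rewrite -(@fsbig_widen _ _ _ _ [set c]) ?fsbig_set1//.
move=> k [_ /eqP kc] /=; case: (ltgtP k c) kc => // [/g0 ->|/Mt ->] // _.
by rewrite raddf0.
Qed.

Lemma mxT_act_val M g c : mxT A M -> is_val g c -> is_val (mx_act M g) c.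
Proof.
move=> [Mt Mi] gc; apply/is_valP; split=> [|r rc].
  rewrite tri_act_lead//; have [[k Mk _] _] := Mi c.
  by rewrite -(raddf0 (M c c)) (inj_eq (can_inj Mk)) gc.1.
have /is_valP [_ g0] := gc.
rewrite (@mx_actE _ _ _ _ _ _ [set: Gam])// fsbig1// => k _.
have [/g0 ->|ck] := ltP k c; first by rewrite raddf0.
by rewrite Mt// (lt_le_trans rc).
Qed.

Lemma mxU_inv M : mxU A M -> exists2 N, mxU A N & M * N = 1 /\ N * M = 1.
Proof.
by move=> [MT [N [NT MN NM]]]; exists N => //; split=> //; exists M.
Qed.

Lemma mxU_mul M N : mxU A M -> mxU A N -> mxU A (M * N).
Proof.
move=> [MT [M' [MT' MM' M'M]]] [NT [N' [NT' NN' N'N]]].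
split; first exact: mxT_mul.
exists (N' * M'); split; first exact: mxT_mul.
  by rewrite mulrA -[M * N * N']mulrA NN' mulr1.
by rewrite mulrA -[N' * M' * M]mulrA M'M mulr1.
Qed.

Lemma mxU_one : mxU A 1.
Proof.
have T1 := mxT1; split=> //.
by exists 1; rewrite mulr1.
Qed.

Lemma mx_act_cancel M N : N * M = 1 -> cancel (mx_act M) (mx_act N).
Proof. by move=> NM g; rewrite -mx_act_mul NM mx_act1. Qed.

Lemma mxU_zmodAut M : mxU A M ->
  exists s : zmodAut (hahnSum A), s =1 mx_act M.
Proof.
move=> [_ [N [_ MN NM]]].
exact: exists_zmodAut (mx_act_cancel NM) (mx_act_cancel MN).
Qed.

Lemma mxT_of (s : zmodAut (hahnSum A)) :
  oAut A s -> val_fixing A s -> mxT A (mx_of s).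
Proof.
move=> s_pos sv; split=> [r c rc a|c].
  have [->|a0] := eqVneq a 0; first by rewrite raddf0.
  by have /sv/is_valP [_ s0] := is_val_single a0; exact: s0.
apply: (@lead_iso _ _ _ s) => //; first by move=> g; exact: sv.
by move=> g; exact: val_fixingV.
Qed.

(** Invertibility in [T], rather than in the ring of all matrices, comes for
    free: the inverse of an element of the right-hand side is again of this
    kind. *)
Lemma aut_image_mxU :
  aut_image mx_act (mxU A) = oAut A `&` val_fixing A.
Proof.
apply/seteqP; split=> [s [M [MT _] sM]|s [s_pos sv]].
  split=> [g [c gc g_pos]|g c gc]; rewrite sM; last exact: mxT_act_val.
  exists c; first exact: mxT_act_val.
  by rewrite (tri_act_lead MT.1 gc) oag_iso_gt0//; exact: MT.2.
exists (mx_of s) => [|g]; last by rewrite mx_act_of.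
split; first exact: mxT_of.
exists (mx_of (s^-1)%g); split.
- by apply: mxT_of; [exact: oAutV | exact: val_fixingV].
- apply: mx_act_inj => g.
  by rewrite mx_act_mul !mx_act_of mx_act1 zmodAutKV.
- apply: mx_act_inj => g.
  by rewrite mx_act_mul !mx_act_of mx_act1 zmodAutVK.
Qed.

Lemma mx_diag_col_finite M c (a : A c) :
  finite_set
    [set r | (if r == c then mx_entry M r c else \0 : {additive A c -> A r}) a
             != 0].
Proof.
apply: (sub_finite_set _ (finite_set1 c)) => r /=.
by have [->|_] := eqVneq r c => //; rewrite eqxx.
Qed.

(** The test [r == c] selects between two maps of the same type
    [A c -> A r], so no transport between components is needed. *)
Definition mx_diag M : Delta A :=
  DeltaMx (mx_entry := fun r c => if r == c then mx_entry M r c else \0)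
    (@mx_diag_col_finite M).

Lemma mx_diag_in M c (a : A c) : mx_diag M c c a = M c c a.
Proof. by rewrite /= eqxx. Qed.

Lemma mx_diag_off M r c (a : A c) : r != c -> mx_diag M r c a = 0.
Proof. by move=> /negPf rc; rewrite /= rc. Qed.

Lemma mx_diag_tri M : lower_triangular (mx_diag M).
Proof. by move=> r c rc a; rewrite mx_diag_off// lt_eqF. Qed.

Lemma mx_diag1 : mx_diag 1 = 1.
Proof.
apply: Delta_eq => r c a; have [->|rc] := eqVneq r c.
  by rewrite mx_diag_in.
by rewrite mx_diag_off ?mx1_off.
Qed.

Lemma mx_diag_idem M : mx_diag (mx_diag M) = mx_diag M.
Proof.
apply: Delta_eq => r c a; have [->|rc] := eqVneq r c.
  by rewrite mx_diag_in.
by rewrite !mx_diag_off.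
Qed.

Lemma mx_diag_mul M N : lower_triangular M -> lower_triangular N ->
  mx_diag (M * N) = mx_diag M * mx_diag N.
Proof.
move=> Mt Nt; apply: Delta_eq => r c a; have [->|rc] := eqVneq r c.
  by rewrite mx_diag_in !tri_mul_diag ?mx_diag_in//; exact: mx_diag_tri.
rewrite mx_diag_off// mx_mulE fsbig1// => k _.
have [->|kc] := eqVneq k c; first exact: mx_diag_off.
by rewrite (@mx_diag_off N k)// raddf0.
Qed.

Lemma mxT_diag M : mxT A M -> mxT A (mx_diag M).
Proof.
move=> [_ Mi]; split=> [|c]; first exact: mx_diag_tri.
by apply: eq_oag_iso (Mi c) => a; rewrite mx_diag_in.
Qed.

Lemma mxU_diag M : mxU A M -> mxU A (mx_diag M).
Proof.
move=> [MT [N [NT MN NM]]]; split; first exact: mxT_diag.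
exists (mx_diag N); split; first exact: mxT_diag.
  by rewrite -mx_diag_mul ?MN ?mx_diag1//; [exact: MT.1 | exact: NT.1].
by rewrite -mx_diag_mul ?NM ?mx_diag1//; [exact: NT.1 | exact: MT.1].
Qed.

Lemma mxU_diag_mul M N : mxU A M -> mxU A N ->
  mx_diag (M * N) = mx_diag M * mx_diag N.
Proof. by move=> [[Mt _] _] [[Nt _] _]; exact: mx_diag_mul. Qed.

Lemma mxU1P M : mxU1 A M <-> mxU A M /\ mx_diag M = 1.
Proof.
split=> -[MU Md]; split=> //.
  apply: Delta_eq => r c a; have [->|rc] := eqVneq r c.
    by rewrite mx_diag_in Md mx1_diag.
  by rewrite mx_diag_off ?mx1_off.
by move=> c a; rewrite -mx_diag_in Md mx1_diag.
Qed.

Lemma mxUdP M : mxUd A M <-> mxU A M /\ mx_diag M = M.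
Proof.
split=> -[MU Md]; split=> //.
  apply: Delta_eq => r c a; have [->|rc] := eqVneq r c.
    by rewrite mx_diag_in.
  by rewrite mx_diag_off ?Md.
by move=> r c rc a; rewrite -Md mx_diag_off.
Qed.

Lemma mx_act_subgroup (S : set (Delta A)) : S 1 ->
  (forall M N, S M -> S N -> S (M * N)) ->
  (forall M, S M -> exists2 N, S N & N * M = 1) ->
  is_subgroup (aut_image mx_act S).
Proof.
move=> S1 SM SV; apply: aut_image_subgroup.
- by exists 1 => // g; rewrite mx_act1.
- move=> M N MS NS; exists (M * N); first exact: SM.
  by move=> g; exact: mx_act_mul.
- by move=> M /SV [N NS NM]; exists N => //; exact: mx_act_cancel.
Qed.

(** The subgroups are the kernel and the image of the idempotent [mx_diag]:
    [M] factors as [M * (mx_diag M)^-1] times [mx_diag M]. *)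
Lemma mxU_sdprod : is_sdprod (aut_image mx_act (mxU1 A))
  (aut_image mx_act (mxUd A)) (aut_image mx_act (mxU A)).
Proof.
apply: sdprod_intro.
- apply: mx_act_subgroup; [exact: mxU_one | exact: mxU_mul|].
  by move=> M /mxU_inv [N NU [_ NM]]; exists N.
- apply: mx_act_subgroup.
  + by apply/mxU1P; split; [exact: mxU_one | exact: mx_diag1].
  + move=> M N /mxU1P [MU Md] /mxU1P [NU Nd]; apply/mxU1P.
    by split; [exact: mxU_mul | rewrite mxU_diag_mul// Md Nd mulr1].
  + move=> M /mxU1P [MU Md]; have [N NU [_ NM]] := mxU_inv MU; exists N => //.
    apply/mxU1P; split=> //.
    by rewrite -[LHS]mulr1 -Md -mxU_diag_mul// NM mx_diag1.
- by move=> s [M [MU _] sM]; exists M.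
- apply: mx_act_subgroup.
  + by apply/mxUdP; split; [exact: mxU_one | exact: mx_diag1].
  + move=> M N /mxUdP [MU Md] /mxUdP [NU Nd]; apply/mxUdP.
    by split; [exact: mxU_mul | rewrite mxU_diag_mul// Md Nd].
  + move=> M /mxUdP [MU Md]; have [N NU [MN NM]] := mxU_inv MU; exists N => //.
    apply/mxUdP; split=> //.
    by rewrite -[LHS]mulr1 -MN mulrA -{1}Md -mxU_diag_mul// NM mx_diag1 mul1r.
- by move=> s [M [MU _] sM]; exists M.
- move=> s t [M /mxU1P [MU Md] sM] [P PU tP].
  have [P' PU' [PP' P'P]] := mxU_inv PU.
  exists (P' * (M * P)).
    apply/mxU1P; split; first by do 2![apply: mxU_mul => //].
    rewrite !mxU_diag_mul//; last exact: mxU_mul.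
    by rewrite Md mul1r -mxU_diag_mul// P'P mx_diag1.
  move=> g; rewrite conjgE !mx_act_mul -tP -sM.
  by apply: zmodAutV_eq => h; rewrite tP; exact: mx_act_cancel.
- move=> s [M /mxU1P [_ M1] sM] [D /mxUdP [_ DD] sD].
  have MD : M = D by apply: mx_act_inj => g; rewrite -sM sD.
  by apply: zmodAut_eq => g; rewrite sD -DD -MD M1 mx_act1.
- move=> s [M MU sM]; have DU := mxU_diag MU.
  have [N NU [DN ND]] := mxU_inv DU.
  have [k kD] := mxU_zmodAut DU.
  exists k.
    by exists (mx_diag M) => //; apply/mxUdP; rewrite mx_diag_idem.
  exists (M * N).
    apply/mxU1P; split; first exact: mxU_mul.
    by rewrite mxU_diag_mul// -mx_diag_idem -mxU_diag_mul// DN mx_diag1.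
  move=> g; rewrite mx_act_mul -sM; congr (s _).
  by apply: zmodAutV_eq => h; rewrite kD; exact: mx_act_cancel.
Qed.

End Triangular.

(** * Automorphisms of the skeleton *)

Section SkeletonLift.
Context {d : Order.disp_t} {Gam : orderType d} {A : Gam -> oagType}.
Implicit Types (g h : hahnSum A) (c r : Gam) (s t : skelAut A).

Lemma skel_indexP s r : exists c, skel_index s c = r.
Proof. by have [f _ fK] := skel_index_bij s; exists (f r). Qed.

(** This determines [skel_lift s g], since every index is of the form
    [skel_index s c]; evaluating only there keeps all coordinates in their
    own types, without transport along the inverse of [skel_index s]. *)
Lemma skel_lift_coef s g c :
  skel_lift s g (skel_index s c) = skel_comp s c (g c).
Proof.
have fg := hahn_finite_supp g; have s_inj := bij_inj (skel_index_bij s).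
rewrite /skel_lift fsbig_finite// coef_sum -fsbig_finite//.
have [gc|/negP gc] := boolP (g c != 0); last first.
  rewrite (supp0 gc) raddf0 fsbig1// => k gk; rewrite single_out//.
  by rewrite (inj_eq s_inj); apply/eqP => ck; rewrite -ck in gk.
rewrite -(@fsbig_widen _ _ _ _ [set c]).
- by rewrite fsbig_set1 single_in.
- by move=> _ ->.
- move=> k [_ kc]; apply: single_out.
  by rewrite (inj_eq s_inj); apply/eqP => ck; apply: kc.
Qed.

Lemma skel_lift_zmod_morphism s : zmod_morphism (skel_lift s).
Proof.
move=> g h; apply: hahn_eq => r; have [c <-] := skel_indexP s r.
rewrite skel_lift_coef [LHS](raddfB (skel_comp s c) (g c) (h c)).
by rewrite -!skel_lift_coef.
Qed.

HB.instance Definition _ s :=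
  GRing.isZmodMorphism.Build _ _ (skel_lift s) (skel_lift_zmod_morphism s).

Lemma skel_lift_mul s t g : skel_lift (s * t)%g g = skel_lift s (skel_lift t g).
Proof.
apply: hahn_eq => r; have [c <-] := skel_indexP (s * t)%g r.
rewrite skel_lift_coef.
change (skel_comp s _ (skel_comp t c (g c)) =
  skel_lift s (skel_lift t g) (skel_index s (skel_index t c))).
by rewrite !skel_lift_coef.
Qed.

Lemma skel_lift1 g : skel_lift 1%g g = g.
Proof. by apply: hahn_eq => c; rewrite (skel_lift_coef 1%g). Qed.

Lemma skel_liftK s : cancel (skel_lift s) (skel_lift (s^-1)%g).
Proof. by move=> g; rewrite -skel_lift_mul mulVg skel_lift1. Qed.

Lemma skel_liftVK s : cancel (skel_lift (s^-1)%g) (skel_lift s).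
Proof. by move=> g; rewrite -skel_lift_mul mulgV skel_lift1. Qed.

Lemma skel_comp_eq0 s c (a : A c) : (skel_comp s c a == 0) = (a == 0).
Proof.
have [[k sk _] _] := skel_comp_iso s c.
by rewrite -(raddf0 (skel_comp s c)) (inj_eq (can_inj sk)).
Qed.

Lemma skel_lift_val s g c :
  is_val g c -> is_val (skel_lift s g) (skel_index s c).
Proof.
move=> /is_valP [gc g0]; apply/is_valP; split=> [|r].
  by rewrite skel_lift_coef skel_comp_eq0.
have [k <-] := skel_indexP s r; rewrite (leW_mono (skel_index_mono s)).
by move=> /g0 gk; rewrite skel_lift_coef gk raddf0.
Qed.

Lemma skel_lift_zmodAut s :
  exists2 t : zmodAut (hahnSum A), (oAut A `&` vAut A) t & t =1 skel_lift s.
Proof.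
have [t ts] := exists_zmodAut (skel_liftK s) (skel_liftVK s).
have tV g c : is_val (t g) (skel_index s c) -> is_val g c.
  move=> tgc; have tg0 := is_val_neq0 tgc.
  have [|r gr] := @exists_val _ _ _ g.
    by apply: contra_neq tg0 => ->; rewrite raddf0.
  have /(is_val_uniq tgc)/(bij_inj (skel_index_bij s)) -> // :
    is_val (t g) (skel_index s r) by rewrite ts; exact: skel_lift_val.
exists t => //; split=> [g [c gc g_pos]|g h].
  exists (skel_index s c); rewrite ts; first exact: skel_lift_val.
  by rewrite skel_lift_coef oag_iso_gt0//; exact: skel_comp_iso.
split=> -[c [r [gc hr cr]]].
  exists (skel_index s c), (skel_index s r).
  by rewrite skel_index_mono !ts; split=> //; exact: skel_lift_val.
have [[c' ec] [r' er]] := (skel_indexP s c, skel_indexP s r).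
rewrite -ec in gc cr; rewrite -er in hr cr; exists c', r'.
by split; [exact: tV | exact: tV | rewrite -(skel_index_mono s)].
Qed.

Context (A_nontrivial : forall c, exists a : A c, a != 0).

(** A trivial [A c] would leave no trace of the index [c] in the lift. *)
Lemma skel_index_lift s t : skel_lift s =1 skel_lift t ->
  skel_index s =1 skel_index t.
Proof.
move=> st c; have [a /is_val_single ac] := A_nontrivial c.
have /is_val_uniq := skel_lift_val s ac; apply.
by rewrite st; exact: skel_lift_val.
Qed.

Lemma skel_lift_inj s t : skel_lift s =1 skel_lift t -> s = t.
Proof.
move=> st; apply: skelAut_eq => c a.
rewrite -[in LHS](single_in a) -[in RHS](single_in a) -!skel_lift_coef.
by rewrite st (skel_index_lift st).
Qed.

(** * The automorphism of the skeleton induced by an automorphism *)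

(** Two elements of equal valuation are related by [val_le] both ways, and so
    are their images; nontriviality of [A c] provides an element of valuation
    [c] to compare with. *)
Lemma induced_index (f : zmodAut (hahnSum A)) : vAut A f ->
  exists ind : Gam -> Gam, forall g c, is_val g c -> is_val (f g) (ind c).
Proof.
move=> fv.
suff /choice [ind indP] : forall c, exists r,
    forall g, is_val g c -> is_val (f g) r.
  by exists ind => g c; exact: indP.
move=> c; have [a a0] := A_nontrivial c; have ac := is_val_single a0.
have [r fr] := exists_val (zmodAut_neq0 f (is_val_neq0 ac)).
exists r => g gc; apply: (val_le_eq fr).
  by apply: (proj1 (fv _ _)); exists c, c.
by apply: (proj1 (fv _ _)); exists c, c.
Qed.

(** The inverse on indices comes from the inverse automorphism. *)
Lemma induced_skelAut (f : zmodAut (hahnSum A)) : (oAut A `&` vAut A) f ->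
  exists s : skelAut A,
    forall g c, is_val g c -> is_val (f g) (skel_index s c).
Proof.
move=> [f_pos fv]; have [ind indP] := induced_index fv.
have [indV indVP] := induced_index (subgroupV vAut_subgroup fv).
have indK : cancel ind indV.
  move=> c; have [a /is_val_single ac] := A_nontrivial c.
  by apply: (is_val_uniq _ ac); rewrite -(zmodAutVK f (hahn_single a)); auto.
have indVK : cancel indV ind.
  move=> c; have [a /is_val_single ac] := A_nontrivial c.
  by apply: (is_val_uniq _ ac); rewrite -(zmodAutKV f (hahn_single a)); auto.
have ind_mono : {mono ind : c r / (c <= r)%O}.
  move=> c r; have [a /is_val_single ac] := A_nontrivial c.
  have [b /is_val_single br] := A_nontrivial r.
  have cmp := val_le_cmp ac br.
  have f_cmp := val_le_cmp (indP _ _ ac) (indP _ _ br).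
  apply/idP/idP => [/f_cmp/(proj2 (fv _ _))/cmp //|].
  by move=> /cmp/(proj1 (fv _ _))/f_cmp.
pose comp c : {additive A c -> A (ind c)} :=
  coef (ind c) \o f \o @hahn_single _ _ A c.
have comp_iso c : is_oag_iso (comp c).
  apply: (@lead_iso _ _ _ f) => // g gr; first exact: indP.
  by rewrite -(indK c); exact: indVP.
by exists (@SkelAut _ _ A ind comp (Bijective indK indVK) ind_mono comp_iso).
Qed.

End SkeletonLift.

(** * Archimedean components *)

Section Archimedean.
Context {d : Order.disp_t} {Gam : orderType d} {A : Gam -> oagType}.
Context (A_arch : forall c, archimedean_oag (A c)).
Implicit Types (g h : hahnSum A) (c r : Gam).

Lemma coef_mulrn g n c : (g *+ n) c = g c *+ n.
Proof. exact: (raddfMn (coef c) n g). Qed.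

(** If [v(g) < v(h)], then [g - h] has leading coefficient [g_c]; if
    [v(g) = v(h)], the archimedean property makes the leading coefficient of a
    multiple of [g] exceed that of [h]; if [v(g) > v(h)], the leading
    coefficient of [g *+ n - h] is that of [- h]. *)
Lemma val_le_archimedean g h : hahn_pos g -> hahn_pos h ->
  val_le g h <-> exists n, hahn_pos (g *+ n - h).
Proof.
move=> [c gc gc_pos] [r hr hr_pos]; rewrite (val_le_cmp gc hr).
have [/is_valP [_ g0] /is_valP [_ h0]] := (gc, hr).
have diff n k : (g *+ n - h) k = g k *+ n - h k.
  by rewrite -coef_mulrn.
split=> [cr|[n [k k_val k_pos]]].
  have [n n_le] : exists n, h c <= g c *+ n by exact: A_arch.
  (* One multiple more than needed for [<=] makes the inequality strict. *)
  have lead : 0 < (g *+ n.+1 - h) c.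
    by rewrite diff mulrS -addrA oag_ltr_pwD// oag_subr_ge0.
  exists n.+1, c => //; apply/is_valP; split=> [|k kc]; first by rewrite gt_eqF.
  by rewrite diff g0// h0 ?mul0rn ?subr0// (lt_le_trans kc).
rewrite leNgt; apply/negP => rc.
have rv : is_val (g *+ n - h) r.
  apply/is_valP; split=> [|l lr]; rewrite diff g0 ?mul0rn ?sub0r//.
  - by rewrite oppr_eq0 hr.1.
  - by rewrite h0 ?oppr0.
  - exact: lt_trans rc.
rewrite -(is_val_uniq rv k_val) diff g0// mul0rn sub0r oag_oppr_gt0 in k_pos.
by have := lt_trans k_pos hr_pos; rewrite ltxx.
Qed.

Lemma val_leNl g h : val_le (- g) h <-> val_le g h.
Proof. by split=> -[c [r [/is_valN gc hr cr]]]; exists c, r. Qed.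

Lemma val_leNr g h : val_le g (- h) <-> val_le g h.
Proof. by split=> -[c [r [gc /is_valN hr cr]]]; exists c, r. Qed.

(** The valuation ignores signs, which reduces to positive [g] and [h]. *)
Lemma oAut_val_le (f : zmodAut (hahnSum A)) g h :
  oAut A f -> val_le g h -> val_le (f g) (f h).
Proof.
move=> f_pos gh.
have [g0 h0] : g != 0 /\ h != 0.
  by have [c [r [/is_val_neq0 g0 /is_val_neq0 h0 _]]] := gh.
wlog g_pos : g g0 gh / hahn_pos g.
  move=> IH; have [/(IH _ g0 gh)//|g_neg] := hahn_pos_or_opp g0.
  apply/val_leNl; rewrite -raddfN; apply: IH => //; first by rewrite oppr_eq0.
  exact/val_leNl.
wlog h_pos : h h0 gh / hahn_pos h.
  move=> IH; have [/(IH _ h0 gh)//|h_neg] := hahn_pos_or_opp h0.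
  apply/val_leNr; rewrite -raddfN; apply: IH => //; first by rewrite oppr_eq0.
  exact/val_leNr.
have /(val_le_archimedean g_pos h_pos) [n /f_pos] := gh.
rewrite raddfB raddfMn => n_pos.
by apply/val_le_archimedean; [exact: f_pos | exact: f_pos | exists n].
Qed.

Lemma oAut_sub_vAut : oAut A `<=` vAut A.
Proof.
move=> f f_pos g h; split=> [|gh]; first exact: oAut_val_le.
rewrite -(zmodAutVK f g) -(zmodAutVK f h).
by apply: oAut_val_le => //; exact: oAutV.
Qed.

End Archimedean.

(** * The decomposition *)

(** For normality: [f] fixes [v(y g)], so [y g] and [f (y g)] have the same
    valuation, and [y^-1] carries this equality back to [g] and [(f ^ y) g].
    For the factorization: [f] and the lift [t] of [k] have the same effect on
    valuations, as [e] is trivial on the index set. *)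
Lemma skel_sdprod (d : Order.disp_t) (Gam : orderType d) (A : Gam -> oagType)
    (A_nontrivial : forall c, exists a : A c, a != 0) (K : set (skelAut A)) :
  is_complement (skelAut_fix_index A) K [set: skelAut A] ->
  is_sdprod (oAut A `&` val_fixing A) (aut_image skel_lift K)
    (oAut A `&` vAut A).
Proof.
move=> [sK NK1 NKT].
have K_sub : aut_image skel_lift K `<=` oAut A `&` vAut A.
  move=> f [k Kk fk]; have [f' f'H f'k] := skel_lift_zmodAut k.
  by rewrite (_ : f = f')//; apply: zmodAut_eq => g; rewrite fk.
apply: sdprod_intro => //.
- exact: subgroupI oAut_subgroup vAut_subgroup.
- exact: subgroupI oAut_subgroup val_fixing_subgroup.
- by move=> f [f_pos /val_fixing_vAut].
- apply: aut_image_subgroup.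
  + by exists 1%g; [exact: sK.1 | exact: skel_lift1].
  + move=> s t Ks Kt; exists (s * t)%g; first exact: subgroupM.
    by move=> g; exact: skel_lift_mul.
  + move=> s Ks; exists (s^-1)%g; first exact: subgroupV.
    exact: skel_liftK.
- move=> f y [f_pos fv] [y_pos yv]; split.
    rewrite conjgE; apply: subgroupM oAut_subgroup _ _; first exact: oAutV.
    exact: subgroupM oAut_subgroup _ _.
  move=> g c gc; have [r yg] := exists_val (zmodAut_neq0 y (is_val_neq0 gc)).
  have fyg := fv _ _ yg.
  have yE : y ((f ^ y)%g g) = f (y g) by rewrite conjgE; exact: zmodAutKV.
  by apply: (val_le_eq gc); apply: (proj2 (yv _ _)); rewrite yE; exists r, r.
- move=> f [_ fv] [k Kk fk].
  have k1 : [set 1%g] k.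
    rewrite -NK1; split=> // c; have [a /is_val_single ac] := A_nontrivial c.
    apply: is_val_uniq (skel_lift_val k ac) _.
    by rewrite -fk; exact: fv.
  by apply: zmodAut_eq => g; rewrite fk k1 skel_lift1.
- move=> f fH; have [s sP] := induced_skelAut A_nontrivial fH.
  have : [set: skelAut A] s by [].
  rewrite -NKT => -[e e_fix [k Kk ek]].
  have [t tH tk] := skel_lift_zmodAut k.
  have Kt : aut_image skel_lift K t by exists k.
  exists t => //; split.
    by apply: oAut_subgroup.2; [exact: fH.1 | exact: tH.1].
  move=> g c gc; set u := (t^-1)%g g.
  have [r ur] := exists_val (zmodAut_neq0 (t^-1)%g (is_val_neq0 gc)).
  have kr : c = skel_index k r.
    apply: is_val_uniq gc _; rewrite -(zmodAutKV t g) tk.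
    exact: skel_lift_val.
  have -> : c = skel_index s r by rewrite -ek kr; exact/esym/e_fix.
  exact: sP.
Qed.

Theorem theorem4p6 (d : Order.disp_t) (Gam : orderType d) (A : Gam -> oagType)
    (A_nontrivial : forall c, exists a : A c, a != 0)
    (K : set (skelAut A))
    (K_complement : is_complement (skelAut_fix_index A) K [set: skelAut A]) :
  [/\ identifies mx_act *%R (mxU A) (oAut A),
      identifies skel_lift *%g [set: skelAut A] (oAut A)
    & exists W : set (zmodAut (hahnSum A)),
        [/\ is_sdprod (aut_image mx_act (mxU1 A)) (aut_image mx_act (mxUd A)) W,
            (forall c, archimedean_oag (A c)) ->
              is_sdprod W (aut_image skel_lift K) (oAut A)
          & is_sdprod W (aut_image skel_lift K) (oAut A `&` vAut A)]].
Proof.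
split.
- split=> [M MU|M N _ _ g|M N _ _]; first last.
  + exact: mx_act_inj.
  + exact: mx_act_mul.
  have [s sM] := mxU_zmodAut MU; exists s => //.
  have : aut_image mx_act (mxU A) s by exists M.
  by rewrite aut_image_mxU => -[].
- split=> [s _|s t _ _ g|s t _ _]; first last.
  + exact: skel_lift_inj.
  + exact: skel_lift_mul.
  by have [t [t_pos _] ts] := skel_lift_zmodAut s; exists t.
have KH := skel_sdprod A_nontrivial K_complement.
exists (aut_image mx_act (mxU A)); split; first exact: mxU_sdprod.
- move=> A_arch; have /setIidPl <- := oAut_sub_vAut A_arch.
  by rewrite aut_image_mxU.
- by rewrite aut_image_mxU.
Qed.
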